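(* Let $G$ be an abelian group of order $n=4t+2$ (written additively, $t\ge1$), and let $D$ be a $k$-subset of $G$ with characteristic function $\chi:G\to\mathrm{GF}(2)$. Let $\phi(x)=(-1)^{\chi(x)}$ and $R=\{(\phi(g),g)\mid g\in G\}\subset\{\pm1\}\times G$. Then the following are equivalent: (i) $\partial\phi$ is quasi-orthogonal; (ii) $D$ is a $(4t+2,k,k-(t+1),(4t+1)(k-t)-k(k-1))$-almost difference set in $G$; (iii) $R$ is an extremal relative $(4t+2,2,4t+2,2t+1)$-quasi-difference set in $\{\pm1\}\times G$ with forbidden subgroup $\{\pm1\}\times\{0\}$; (iv) $\phi$ is an optimal binary array, i.e. $R_\phi(g)=\pm2$ for all $g\in G\setminus\{0\}$. If no difference set with parameters $\bigl(n,\frac{n\pm\sqrt{3n-2}}{2},\frac{n+2\pm2\sqrt{3n-2}}{4}\bigr)$ exists, then (i)–(iv) are further equivalent to (v) $\chi$ has optimal nonlinearity $(t+1)/(2t+1)$.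
   Context: $\partial\phi(x,y)=\phi(x)\phi(y)\phi(x+y)$; $R_\phi(g)=\sum_{x\in G}\phi(x)\phi(x+g)$. For a normalized cocycle $\psi:G\times G\to\{\pm1\}$ with matrix $M_\psi=[\psi(g,h)]_{g,h}$, the row excess is $RE(M_\psi)=\sum_{g\ne0}|\sum_h\psi(g,h)|$; a coboundary $\psi$ (such as $\partial\phi$) is quasi-orthogonal iff $RE(M_\psi)=8t+2$ (a non-coboundary is quasi-orthogonal iff $RE=4t$). A $(v,k,\lambda,s)$-almost difference set in $G$ ($|G|=v$) is a $k$-subset $D$ such that for $s$ of the nonzero $g\in G$ the number of pairs $(x,y)\in D^2$ with $x-y=g$ is $\lambda$, and for the remaining $v-1-s$ nonzero $g$ it is $\lambda+1$. Relative quasi-difference set: for a group $\mathcal E$ of order $8t+4$ and normal $Z\cong\mathbb Z_2$, a transversal $R$ for $Z$ in $\mathcal E$ containing $S\subset R\setminus\{1\}$ with $|S|\in\{0,2t+1\}$ such that for all $x\in\mathcal E\setminus Z$, $|R\cap xR|=2t+1$ if $x\in SZ$ and $|R\cap xR|\in\{2t,2t+2\}$ otherwise; extremal means $S=\emptyset$. Nonlinearity of $f:G\to\mathrm{GF}(2)$: $P_f=\max_{0\ne a\in G}\max_{b\in\mathrm{GF}(2)}|\{x\in G: f(x+a)-f(x)=b\}|/|G|$; for $|G|=4t+2$ the optimal value is $(t+1)/(2t+1)$. A $(v,k,\lambda)$-difference set is a $k$-subset of a group of order $v$ in which every nonidentity element has exactly $\lambda$ representations as a difference. *)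

(* Defs.v *)
From HB Require Import structures.
From mathcomp Require Import all_boot all_order all_algebra all_fingroup.
From mathcomp Require Import all_solvable all_field.
Set Implicit Arguments.
Unset Strict Implicit.
Unset Printing Implicit Defensive.
Import Order.TTheory GRing.Theory Num.Theory.
Local Open Scope ring_scope.

(* The multiplicative group {1, -1} of units of int. *)
Record pm1 := Pm1 { pm1_val :> int; pm1P : pm1_val \in [:: 1; -1] }.

HB.instance Definition _ := [isSub for pm1_val].
HB.instance Definition _ := [Countable of pm1 by <:].

Definition pm1_one : pm1 := @Pm1 1 isT.
Definition pm1_m1 : pm1 := @Pm1 (-1) isT.

Lemma pm1_enumP : Finite.axiom [:: pm1_one; pm1_m1].
Proof.
case=> x xP; rewrite /= -!val_eqE /=; move: xP; rewrite !inE.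
by case/orP=> /eqP->.
Qed.

HB.instance Definition _ := isFinite.Build pm1 pm1_enumP.

Lemma pm1_mul_subproof (a b : pm1) : (a : int) * (b : int) \in [:: 1; -1].
Proof.
case: a b => [a aP] [b bP] /=; move: aP bP; rewrite !inE.
by do 2![case/orP=> /eqP->].
Qed.

Definition pm1_mul (a b : pm1) : pm1 := Pm1 (pm1_mul_subproof a b).

Lemma pm1_mulA : associative pm1_mul.
Proof. by move=> a b c; apply: val_inj; rewrite /= mulrA. Qed.

Lemma pm1_mul1 : left_id pm1_one pm1_mul.
Proof. by move=> a; apply: val_inj; rewrite /= mul1r. Qed.

Lemma pm1_mulV : left_inverse pm1_one id pm1_mul.
Proof.
case=> a aP; apply: val_inj; move: aP; rewrite /= !inE.
by case/orP=> /eqP->.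
Qed.

HB.instance Definition _ := Finite_isGroup.Build pm1 pm1_mulA pm1_mul1 pm1_mulV.

Section AdditiveGroup.
Variable G : finZmodType.
Implicit Types (phi : G -> pm1) (psi : G -> G -> pm1) (D : {set G}).

Definition cobound phi : G -> G -> pm1 :=
  fun x y => (phi x * phi y * phi (x + y)%R)%g.

Definition autocorr phi (g : G) : int :=
  \sum_(x : G) (phi x : int) * (phi (x + g) : int).

Definition is_cocycle psi : Prop :=
  forall g h k : G,
    (psi g h * psi (g + h)%R k)%g = (psi g (h + k)%R * psi h k)%g.

Definition is_coboundary psi : Prop :=
  exists phi, forall x y, psi x y = cobound phi x y.

Definition row_excess psi : int :=
  \sum_(g : G | g != 0) `| \sum_(h : G) (psi g h : int) |.

(* For #|G| = 4t + 2.  Normalization of psi is not imposed: a binary cocycle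
   psi has psi g 0 = psi 0 g = psi 0 0 for all g, so it or its negation is
   normalized, and both have the same row excess; psi and its negation are
   also simultaneously coboundaries, as - 1 is the coboundary of - 1. *)
Definition quasi_orthogonal (t : nat) psi : Prop :=
  [/\ is_cocycle psi,
      is_coboundary psi -> row_excess psi = (8 * t + 2)%N%:Z
    & ~ is_coboundary psi -> row_excess psi = (4 * t)%N%:Z].

Definition num_diffs D (g : G) : nat :=
  #|[set p : G * G | [&& p.1 \in D, p.2 \in D & p.1 - p.2 == g]]|.

(* l and s are integers because the parameter formulas of interest, such as
   k - (t + 1), may be negative. *)
Definition almost_difference_set (v k : nat) (l s : int) D : Prop :=
  [/\ #|G| = v, #|D| = k,
      #|[set g : G | (g != 0) && ((num_diffs D g)%:Z == l)]|%:Z = s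
    & forall g : G, g != 0 ->
        (num_diffs D g)%:Z = l \/ (num_diffs D g)%:Z = l + 1].

Definition optimal_binary_array phi : Prop :=
  forall g : G, g != 0 -> autocorr phi g = 2 \/ autocorr phi g = - 2.

Definition charfun D : G -> 'F_2 := fun x => (x \in D)%:R.

Definition sign_fun D : G -> pm1 :=
  fun x => (pm1_m1 ^+ (charfun D x : nat))%g.

(* The default value 0 of the iterated maxima is harmless, all the ratios
   being nonnegative. *)
Definition nonlinearity (f : G -> 'F_2) : rat :=
  \big[Num.max/0]_(a : G | a != 0) \big[Num.max/0]_(b : 'F_2)
    (#|[set x : G | f (x + a) - f x == b]|%:R / #|G|%:R).

(* G is used here as a multiplicatively written group whose law is +. *)
Definition graph_set phi : {set pm1 * G} := [set (phi g, g) | g : G].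

Definition sign_subgroup : {group pm1 * G} :=
  [group of setX [set: pm1] [1 G]%g].

End AdditiveGroup.

(* The parameters are (4t + 2, 2, 4t + 2, 2t + 1), Z is the forbidden
   subgroup. *)
Definition relative_quasi_difference_set (E : finGroupType) (t : nat)
    (Z : {group E}) (R S : {set E}) : Prop :=
  [/\ #|E| = (8 * t + 4)%N,
      (Z <| [set: E])%g /\ (Z \isog [set: 'Z_2])%g,
      is_transversal R (rcosets Z [set: E]) [set: E],
      S \subset R :\ 1%g /\ (#|S| = 0%N \/ #|S| = (2 * t + 1)%N)
    & forall x : E, x \notin Z ->
        if x \in (S * Z)%g
        then #|R :&: (x *: R)%g| = (2 * t + 1)%N
        else #|R :&: (x *: R)%g| = (2 * t)%N
             \/ #|R :&: (x *: R)%g| = (2 * t + 2)%N].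

Definition extremal_relative_quasi_difference_set (E : finGroupType) (t : nat)
    (Z : {group E}) (R : {set E}) : Prop :=
  relative_quasi_difference_set t Z R set0.

Definition difference_set (H : finGroupType) (v k l : nat) (B : {set H}) :
    Prop :=
  [/\ #|H| = v, #|B| = k
    & forall g : H, g != 1%g ->
        #|[set p : H * H
            | [&& p.1 \in B, p.2 \in B & (p.1 * p.2^-1)%g == g]]| = l].

(* b selects the sign, the same in k and in l.  The square roots are taken in
   algC: when the two expressions are not natural numbers, no difference set
   can have them as parameters. *)
Definition exceptional_parameters (n : nat) (b : bool) (k l : nat) : Prop :=
  let r : algC := (-1) ^+ b * sqrtC (3 * n%:R - 2) in
  k%:R = (n%:R + r) / 2 :> algC /\ l%:R = (n%:R + 2 + 2 * r) / 4 :> algC.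

(* Main.v *)
Require Import Defs.
From HB Require Import structures.
From mathcomp Require Import all_boot all_order all_algebra all_fingroup.
From mathcomp Require Import all_solvable all_field zify ring lra.
Import Order.TTheory GRing.Theory FinRing.Theory Num.Theory.
Local Open Scope ring_scope.

(** Everything is read off the autocorrelation [A g] of [phi]. Counting pairs
    in [D] gives [A g = 4t + 2 - 4k + 4 N g], where [N g] is the number of
    representations of [g] as a difference; hence [A g] is [2] modulo [4] and
    [|A g| >= 2]. The row excess is the sum of the [|A g|], so its least
    possible value [8t + 2] forces [|A g| = 2] throughout; [A g = -2, 2] means
    [N g = k - t - 1, k - t]; and the number of [x] with
    [phi (x + g) = e phi x] is [2t + 1 + e A g / 2], which is both the size of
    [R :&: (e, g) R] and the count occurring in the nonlinearity. *)

Lemma pm1_eqVeq (e : pm1) : e = pm1_one \/ e = pm1_m1.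
Proof.
case: e => x xP; have := xP; rewrite !inE.
by case/orP=> /eqP eq_x; [left | right]; apply: val_inj.
Qed.

Lemma card_pm1 : #|{: pm1}| = 2%N.
Proof. by rewrite cardE enumT unlock. Qed.

Lemma pm1_mulC (a b : pm1) : (a * b = b * a)%g.
Proof. by apply: val_inj; rewrite /= mulrC. Qed.

Lemma intz_card (T : finType) (P : pred T) :
  #|[set x | P x]|%:Z = \sum_(x : T) (P x : nat)%:Z.
Proof.
rewrite -sum1_card -natz natr_sum big_mkcond; apply: eq_bigr => x _.
by rewrite inE; case: (P x).
Qed.

Lemma intz_cards (T : finType) (A : {set T}) :
  #|A|%:Z = \sum_(x : T) (x \in A)%:Z.
Proof.
rewrite -(intz_card _ (mem A)); congr (_%:Z).
by apply: eq_card => x; rewrite inE.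
Qed.

(** * Autocorrelation, difference counts and row excess *)

Section Autocorrelation.
Variable G : finZmodType.
Implicit Types (phi : G -> pm1) (D : {set G}) (g : G).

Lemma reindex_addr (F : G -> int) g : \sum_x F (x + g) = \sum_x F x.
Proof. by rewrite [RHS](reindex_inj (addIr g)). Qed.

Lemma sumz_const (c : int) : \sum_(x : G) c = #|G|%:Z * c.
Proof. by rewrite sumr_const -mulr_natl natz. Qed.

Lemma card_neq0 : #|[pred g : G | g != 0]| = #|G|.-1.
Proof. by rewrite -(cardC1 (0 : G)); apply: eq_card. Qed.

(** For signs, twice the truth value of [phi (x + g) = e phi x] is [1 + e phi x phi (x + g)]; this
    is summed over [x]. *)
Lemma card_autocorr phi (e : pm1) g :
  2 * #|[set x | phi (x + g) == (e * phi x)%g]|%:Z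
    = #|G|%:Z + (e : int) * autocorr phi g.
Proof.
rewrite intz_card /autocorr !mulr_sumr -[#|G|%:Z]mulr1 -sumz_const -big_split.
apply: eq_bigr => x _ /=.
by case: (pm1_eqVeq e) (pm1_eqVeq (phi x)) (pm1_eqVeq (phi (x + g)))
   => -> [] -> [] ->.
Qed.

Lemma sign_funE D x : (sign_fun D x : int) = 1 - 2 * (x \in D)%:Z.
Proof. by rewrite /sign_fun /charfun; case: (x \in D). Qed.

Lemma num_diffsE D g :
  (num_diffs D g)%:Z = \sum_(x : G) (x \in D)%:Z * (x + g \in D)%:Z.
Proof.
rewrite /num_diffs.
(* A pair with difference [g] is [(x + g, x)], hence determined by its second entry. *)
have -> : [set p : G * G | [&& p.1 \in D, p.2 \in D & p.1 - p.2 == g]]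
    = [set (x + g, x) | x in [set x | (x \in D) && (x + g \in D)]].
  apply/setP=> -[x y]; rewrite !inE /=; apply/and3P/imsetP.
    case=> Dx Dy /eqP eq_g; exists y; rewrite ?inE -eq_g addrC subrK ?Dy //.
  by case=> z; rewrite inE => /andP[Dz Dzg] [-> ->]; rewrite Dz Dzg addrC addKr.
rewrite card_imset => [|x y [_ //]]; rewrite intz_card.
by apply: eq_bigr => x _; case: (x \in D) => //=; rewrite ?mul1r.
Qed.

Lemma autocorr_sign_fun D g :
  autocorr (sign_fun D) g
    = #|G|%:Z - 4 * #|D|%:Z + 4 * (num_diffs D g)%:Z.
Proof.
have cardD := intz_cards _ D.
have cardDg : #|D|%:Z = \sum_(x : G) (x + g \in D)%:Z.
  by rewrite cardD (reindex_addr (fun x => (x \in D)%:Z)).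
(* The summand is [(1 - 2a)(1 - 2b)] with [a], [b] the indicators of [x] and [x + g] in [D]; each of
   the two linear terms sums to [2 * #|D|]. *)
transitivity (#|G|%:Z - 2 * #|D|%:Z - 2 * #|D|%:Z + 4 * (num_diffs D g)%:Z);
  last by ring.
rewrite {1}cardD cardDg num_diffsE -[#|G|%:Z]mulr1 -sumz_const.
rewrite !mulr_sumr -!sumrB -big_split.
by apply: eq_bigr => x _; rewrite /= !sign_funE; ring.
Qed.

Lemma num_diffs0 D : num_diffs D 0 = #|D|.
Proof.
apply/eqP; rewrite -eqz_nat; apply/eqP; rewrite num_diffsE intz_cards.
by apply: eq_bigr => x _; rewrite addr0; case: (x \in D).
Qed.

(** Sorting the ordered pairs of elements of [D] by difference, the [#|D|] diagonal pairs account
    for [g = 0]. This yields the fourth parameter of the almost difference set. *)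
Lemma sum_num_diffs D :
  \sum_(g : G | g != 0) (num_diffs D g)%:Z = #|D|%:Z * (#|D|%:Z - 1).
Proof.
have cardD := intz_cards _ D.
have : \sum_(g : G) (num_diffs D g)%:Z = #|D|%:Z * #|D|%:Z.
  under eq_bigr do rewrite num_diffsE.
  rewrite exchange_big {1}cardD mulr_suml; apply: eq_bigr => x _ /=.
  rewrite -mulr_sumr cardD -(reindex_addr (fun y => (y \in D)%:Z) x).
  by under eq_bigr do rewrite addrC.
by rewrite (bigD1 (0 : G)) //= num_diffs0 => /(canRL (addKr _)) ->; ring.
Qed.

Lemma cobound_cocycle phi : is_cocycle (cobound phi).
Proof.
move=> g h k; apply: val_inj; rewrite /= addrA.
by case: (pm1_eqVeq (phi g)) (pm1_eqVeq (phi h)) (pm1_eqVeq (phi k))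
  (pm1_eqVeq (phi (g + h))) (pm1_eqVeq (phi (h + k)))
  (pm1_eqVeq (phi (g + h + k)))
  => -> [] -> [] -> [] -> [] -> [] ->.
Qed.

(** The sum of row [g] is the autocorrelation at [g] times the sign [phi g], which the absolute
    value removes. *)
Lemma row_excess_cobound phi :
  row_excess (cobound phi) = \sum_(g : G | g != 0) `|autocorr phi g|.
Proof.
apply: eq_bigr => g _.
have -> : \sum_h (cobound phi g h : int) = (phi g : int) * autocorr phi g.
  by rewrite mulr_sumr; apply: eq_bigr => h _; rewrite /= mulrA (addrC g).
by case: (pm1_eqVeq (phi g)) => ->; rewrite ?mul1r // mulN1r normrN.
Qed.

(** [phi] itself witnesses that [cobound phi] is a coboundary, which selects the value [8t + 2]. *)
Lemma quasi_orthogonal_cobound t phi :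
  quasi_orthogonal t (cobound phi)
    <-> row_excess (cobound phi) = (8 * t + 2)%N%:Z.
Proof.
have cob : is_coboundary (cobound phi) by exists phi.
by split=> [[_ ->]//|re]; split=> //; apply: cobound_cocycle.
Qed.

End Autocorrelation.

(** * Comparison of each condition with optimality of the array *)

Section OptimalArrays.
Variables (G : finZmodType) (t : nat) (D : {set G}).
Hypothesis cardG : #|G| = (4 * t + 2)%N.
Local Notation phi := (sign_fun D).

Lemma quasi_orthogonalP :
  quasi_orthogonal t (cobound phi) <-> optimal_binary_array phi.
Proof.
rewrite quasi_orthogonal_cobound row_excess_cobound.
(* There are [4t + 1] nonzero [g], each contributing the minimum [2]. *)
have -> : (8 * t + 2)%N%:Z = \sum_(g : G | g != 0) 2.
  by rewrite sumr_const card_neq0 cardG -mulr_natl; lia.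
split=> [/eqP|opt]; last first.
  by apply: eq_bigr => g /opt[] ->.
rewrite -subr_eq0 -sumrB => /eqP sum0 g g0.
(* The value is [2] modulo [4], which excludes [-1], [0] and [1]. *)
have ge0 h : h != 0 -> 0 <= `|autocorr phi h| - 2.
  by rewrite autocorr_sign_fun cardG; lia.
by have := psumr_eq0P ge0 sum0 g0; lia.
Qed.

Lemma almost_difference_setP :
  let k := #|D| in
  almost_difference_set (4 * t + 2) k (k%:Z - (t%:Z + 1))
    ((4 * t%:Z + 1) * (k%:Z - t%:Z) - k%:Z * (k%:Z - 1)) D
  <-> optimal_binary_array phi.
Proof.
move=> k; split=> [[_ _ _ ads] g /ads | opt].
  by rewrite autocorr_sign_fun cardG -/k; lia.
have ads g : g != 0 -> (num_diffs D g)%:Z = k%:Z - (t%:Z + 1)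
    \/ (num_diffs D g)%:Z = k%:Z - (t%:Z + 1) + 1.
  by move=> /opt; rewrite autocorr_sign_fun cardG -/k; lia.
(* Each [k - t - num_diffs D g] is [1] at the lower value and [0] at the upper one, so the sum of
   these defects over [g != 0] counts the lower values. *)
split=> //; rewrite -/k -sum_num_diffs intz_card.
have -> : (4 * t%:Z + 1) * (k%:Z - t%:Z)
    = \sum_(g : G | g != 0) (k%:Z - t%:Z).
  rewrite sumr_const card_neq0 cardG -[RHS]mulr_natl natz.
  by congr (_ * _); lia.
rewrite -sumrB [RHS]big_mkcond; apply: eq_bigr => g _.
by have [//|/= /ads] := eqVneq g 0; case: eqP => [->|_ [//|->]] *; lia.
Qed.

Lemma mem_sign_subgroup (x : pm1 * G) : (x \in sign_subgroup G) = (x.2 == 0).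
Proof. by rewrite !inE. Qed.

Lemma mem_graph_set (f : G -> pm1) (x : pm1 * G) :
  (x \in graph_set f) = (x.1 == f x.2).
Proof.
apply/imsetP/eqP => [[g _ -> //]|eq_x]; exists x.2 => //.
by rewrite -eq_x -surjective_pairing.
Qed.

(** The point of the graph above [x + g] lies in the translate exactly when its sign is
    [e * f x]. *)
Lemma card_graph_set_lcoset (f : G -> pm1) (e : pm1) (g : G) :
  #|graph_set f :&: ((e, g) *: graph_set f)%g|
    = #|[set x | f (x + g) == (e * f x)%g]|.
Proof.
rewrite -(card_imset _ (_ : injective (fun x : G => (f (x + g), x + g))));
  last by move=> x y [_ /addIr].
apply: eq_card => -[e' y]; rewrite inE mem_graph_set /= mem_lcoset mem_graph_set.
apply/andP/imsetP => [[/eqP -> /eqP eq_f]|[x]].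
  exists (y - g); rewrite ?subrK // inE subrK.
  have -> : y - g = (g^-1 * y)%g by rewrite zmodMgE zmodVgE addrC.
  by apply/eqP; rewrite -eq_f mulKVg.
rewrite inE => /eqP eq_f [-> ->] /=; split=> //.
by rewrite eq_f mulKg zmodMgE zmodVgE addrC addrK.
Qed.

Lemma quasi_difference_setP :
  extremal_relative_quasi_difference_set t (sign_subgroup G) (graph_set phi)
  <-> optimal_binary_array phi.
Proof.
have cardR := card_autocorr G phi.
split=> [[_ _ _ _ qds] g g0 | opt].
  (* The sign [1] suffices, since the count for [e = 1] alone determines the autocorrelation at
     [g]. *)
  have := qds (pm1_one, g); rewrite mem_sign_subgroup /= g0 => /(_ isT).
  rewrite mul0g inE card_graph_set_lcoset.
  by have := cardR pm1_one g; rewrite cardG mul1r; lia.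
split.
- by rewrite card_prod card_pm1 cardG; lia.
- have abE : abelian [set: pm1 * G].
    by apply/centsP=> -[a x] _ [b y] _; congr (_, _);
      [apply: pm1_mulC | apply: zmod_mulgC].
  split; first by rewrite -sub_abelian_normal.
  have cardZ : #|sign_subgroup G| = 2%N.
    by rewrite cardsX cardsT card_pm1 cards1.
  rewrite isog_cyclic_card ?prime_cyclic ?cardZ //.
    by rewrite cardsT card_ord.
  by rewrite cardsT card_ord.
- rewrite /is_transversal rcosets_partition ?subsetT //=.
  apply/forall_inP => B /rcosetsP[[e g] _ ->].
  (* The coset of [(e, g)] consists of both signs above [g], and the graph contains just one of
     them. *)
  apply/cards1P; exists (phi g, g); apply/setP => -[e' g'].
  rewrite in_setI mem_graph_set mem_rcoset mem_sign_subgroup in_set1 /=.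
  rewrite xpair_eqE -[(_ * _)%g]/(g' - g) subr_eq0.
  by have [->|_] := eqVneq g' g; rewrite ?andbF.
- by rewrite sub0set cards0; split; [|left].
case=> e g; rewrite mem_sign_subgroup /= mul0g inE card_graph_set_lcoset => g0.
have := cardR e g; rewrite cardG.
by case: (pm1_eqVeq e) (opt g g0) => -> [] -> /=; lia.
Qed.

(** Through [(-1)^b], differences in ['F_2] become quotients of signs, so this is [card_autocorr] at
    [e = (-1)^b]. *)
Lemma card_charfun_diff (a : G) (b : 'F_2) :
  2 * #|[set x | charfun D (x + a) - charfun D x == b]|%:Z
    = #|G|%:Z + (-1) ^+ b * autocorr phi a.
Proof.
have <- : ((pm1_m1 ^+ b)%g : int) = (-1) ^+ b by case: b => [[|[|]]].
rewrite -card_autocorr; congr (2 * _%:Z); apply: eq_card => x; rewrite !inE.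
rewrite /sign_fun /charfun.
by case: b (x + a \in D) (x \in D) => [[|[|//]] ?] [] [].
Qed.

Lemma nonlinearityP : (1 <= t)%N ->
  nonlinearity (charfun D) = (t%:R + 1) / (2 * t%:R + 1)
  <-> optimal_binary_array phi.
Proof.
move=> t1; set c : rat := (X in _ = X).
pose N a (b : 'F_2) := #|[set x | charfun D (x + a) - charfun D x == b]|.
(* Over the denominator [#|G|] the optimal value has numerator [2t + 2], so bounds on ratios become
   bounds on counts. *)
have cE : c = (2 * t + 2)%N%:R / #|G|%:R.
  have t0 := ler0n rat t.
  rewrite /c cardG (natrD _ (2 * t)) (natrD _ (4 * t)) !natrM; field.
  by apply/andP; split; apply: lt0r_neq0; lra.
have leNc a b : ((N a b)%:R / #|G|%:R <= c) = (N a b <= 2 * t + 2)%N.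
  by rewrite cE ler_pM2r ?ler_nat // invr_gt0 ltr0n cardG; lia.
split=> [nl a a0 | opt].
  have leN b : (N a b <= 2 * t + 2)%N.
    rewrite -leNc -nl; apply: (bigmax_sup a) => //.
    exact: (le_bigmax _ (fun b => (N a b)%:R / _)).
  (* The counts for [b = 0] and [b = 1] bound the autocorrelation by [2] and [-2]; its residue
     modulo [4] leaves only these two ends. *)
  have := card_charfun_diff a 0; have := card_charfun_diff a 1.
  have := leN 0; have := leN 1; rewrite /N cardG expr0 expr1 autocorr_sign_fun.
  by rewrite cardG; lia.
have N_opt a b : a != 0 -> (N a b = 2 * t \/ N a b = 2 * t + 2)%N.
  move=> /opt; have := card_charfun_diff a b; rewrite -/(N a b) cardG.
  by case: b => [[|[|//]] ?] /=; rewrite ?expr0 ?expr1; lia.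
apply/le_anti/andP; split.
  (* The iterated maxima start from [0], which must also lie below [c]. *)
  have c0 : 0 <= c by rewrite cE divr_ge0 ?ler0n.
  apply: bigmax_le => // a a0; apply: bigmax_le => // b _.
  by rewrite leNc; case: (N_opt a b a0) => ->; lia.
have [a a0] : exists a : G, a != 0.
  by apply/card_gt0P; rewrite card_neq0 cardG; lia.
(* The maximum is attained at [b = 0] if the autocorrelation at [a] is [2], and at [b = 1] if it is
   [-2]. *)
have [b Nb] : exists b, N a b = (2 * t + 2)%N.
  have := card_charfun_diff a 0; have := card_charfun_diff a 1.
  rewrite -!/(N a _) cardG expr0 expr1 => N1 N0.
  by case: (opt a a0) => A2; [exists 0 | exists 1]; lia.
apply: (bigmax_sup a) => //; apply: (bigmax_sup b) => //.
by rewrite cE -Nb.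
Qed.

End OptimalArrays.

Theorem theorem4 (t : nat) (ht : (1 <= t)%N)
    (G : finZmodType) (hG : #|G| = (4 * t + 2)%N)
    (k : nat) (D : {set G}) (hD : #|D| = k) :
  let n := (4 * t + 2)%N in
  let chi := charfun D in
  let phi := sign_fun D in
  let R := graph_set phi in
  let i := quasi_orthogonal t (cobound phi) in
  let ii := almost_difference_set (4 * t + 2) k
              (k%:Z - (t%:Z + 1))
              ((4 * t%:Z + 1) * (k%:Z - t%:Z) - k%:Z * (k%:Z - 1)) D in
  let iii := extremal_relative_quasi_difference_set t (sign_subgroup G) R in
  let iv := optimal_binary_array phi in
  let v := nonlinearity chi = (t%:R + 1) / (2 * t%:R + 1) in
  [<-> i; ii; iii; iv] /\
  ((forall (b : bool) (k' l' : nat), exceptional_parameters n b k' l' ->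
      forall (H : finGroupType) (B : {set H}), ~ difference_set n k' l' B) ->
   [<-> i; ii; iii; iv; v]).
Proof.
move=> n chi phi R i ii iii iv v; subst k.
have I : i <-> iv by apply: quasi_orthogonalP.
have II : ii <-> iv by apply: almost_difference_setP.
have III : iii <-> iv by apply: quasi_difference_setP.
have V : v <-> iv by apply: nonlinearityP.
by split=> [|_]; tfae; tauto.
Qed.
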